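(* Let $k\subset K$ be a field extension, let $V=K^n_\phi$ be an $S$-homogeneous two-sided vector space, where $S$ is a simple two-sided vector space with $\dim_KS=m$. Suppose $|k|>m$, $K$ is perfect, and $K\subset F$ is an extension of fields. If $M$ is a free rank $[S]$ family generated by $\phi$-invariants over $\operatorname{Spec}F$, then $M\cong F\otimes_KS$ as $F\otimes_kK$-modules.
   Context: A two-sided vector space is a $k$-central $K$-$K$-bimodule that is finite-dimensional as a left $K$-module (equivalently, a $K\otimes_kK$-module finite-dimensional over the left factor); $\dim_K$ is left dimension. For a $k$-algebra homomorphism $\phi:K\to M_n(K)$, $K^n_\phi$ is the two-sided vector space $K^n$ (row vectors) with the usual left action and right action $v\cdot x=v\phi(x)$. For an extension field $F$ of $K$, $F\otimes_kK$ acts on $F^n$ by $(f\otimes x)\cdot v=f\,v\phi(x)$. $V$ is $S$-homogeneous if all its composition factors are isomorphic to $S$ ($V$ need not be semisimple). A free rank $[S]$ family generated by $\phi$-invariants over $\operatorname{Spec}F$ is an element of $G_\phi([S],V)(F)=G_{\operatorname{im}\phi}(m,n)(F)$, i.e. an $m$-dimensional $F$-subspace $M\subset F^n$ such that the image of $\bigwedge^mM$ in $\bigwedge^mF^n\cong F\otimes_K\bigwedge^mK^n$ is generated by an element of the form $\sum_ir_i\otimes v_{i1}\wedge\cdots\wedge v_{im}$, $r_i\in F$, where for each $i$, $\{v_{i1},\dots,v_{im}\}$ is a basis of an $m$-dimensional subspace of $K^n$ invariant under right multiplication by $\operatorname{im}\phi$. *)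

(* Defs.v *)
From HB Require Import structures.
From mathcomp Require Import all_boot all_order all_algebra all_field.

Set Implicit Arguments.
Unset Strict Implicit.
Unset Printing Implicit Defensive.

Import GRing.Theory passmx.
Local Open Scope ring_scope.

Definition card_gt (T : eqType) (m : nat) : Prop :=
  exists s : seq T, uniq s /\ (m < size s)%N.

Definition perfect_field (K : fieldType) : Prop :=
  forall p : {poly K}, irreducible_poly p -> separable_poly p.

(* A module over F (x)_k K of finite dimension over F, seen as a k-central
   F-K-bimodule.  The inclusions of k in F and K are the morphisms iF, iK. *)
Record bimod (k F K : fieldType) (iF : {rmorphism k -> F})
    (iK : {rmorphism k -> K}) := Bimod {
  bicar :> vectType F;
  ract : bicar -> K -> bicar;
  ract_linear : forall x, linear (ract^~ x);
  ractD : forall v x y, ract v (x + y) = ract v x + ract v y;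
  ract1 : forall v, ract v 1 = v;
  ractM : forall v x y, ract v (x * y) = ract (ract v x) y;
  ract_central : forall v a, ract v (iK a) = iF a *: v
}.
Arguments ract {k F K iF iK} _ _ _.

Definition two_sided (k K : fieldType) (i : {rmorphism k -> K}) := bimod i i.

Section Bimodules.
Variables (k F K : fieldType) (iF : {rmorphism k -> F}).
Variable (iK : {rmorphism k -> K}).
Implicit Types V W T : bimod iF iK.

Definition ractr V (x : K) (v : V) : V := ract V v x.

HB.instance Definition _ V x :=
  GRing.isLinear.Build F V V *:%R (ractr x) (@ract_linear _ _ _ _ _ V x).

Definition bimod_hom V W (f : 'Hom(V, W)) : Prop :=
  forall v x, f (ract V v x) = ract W (f v) x.

Definition bimod_iso V W : Prop :=
  exists f : 'Hom(V, W), bimod_hom f /\ bijective f.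

Definition stable V (U : {vspace V}) : Prop :=
  forall v x, v \in U -> ract V v x \in U.

Section SubBimodule.
Variables (V : bimod iF iK) (U : {vspace V}) (sU : stable U).

Definition sub_ract (v : subvs_of U) (x : K) : subvs_of U :=
  vsproj U (ract V (vsval v) x).

Lemma vsval_sub_ract v x : vsval (sub_ract v x) = ract V (vsval v) x.
Proof. by rewrite vsprojK // sU // subvsP. Qed.

Fact sub_ract_linear x : linear (sub_ract^~ x).
Proof.
by move=> a u v; rewrite /sub_ract [vsval _]linearP ract_linear linearP.
Qed.

Fact sub_ractD v x y : sub_ract v (x + y) = sub_ract v x + sub_ract v y.
Proof. by apply: subvs_inj; rewrite linearD /= !vsval_sub_ract ractD. Qed.

Fact sub_ract1 v : sub_ract v 1 = v.
Proof. by apply: subvs_inj; rewrite vsval_sub_ract ract1. Qed.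

Fact sub_ractM v x y : sub_ract v (x * y) = sub_ract (sub_ract v x) y.
Proof. by apply: subvs_inj; rewrite !vsval_sub_ract ractM. Qed.

Fact sub_ract_central v a : sub_ract v (iK a) = iF a *: v.
Proof. by apply: subvs_inj; rewrite linearZ /= vsval_sub_ract ract_central. Qed.

Definition sub_bimod : bimod iF iK :=
  Bimod sub_ract_linear sub_ractD sub_ract1 sub_ractM sub_ract_central.

End SubBimodule.

Definition simple_bimod V : Prop :=
  (fullv : {vspace V}) <> 0%VS /\
  forall U : {vspace V}, stable U -> U = 0%VS \/ U = fullv.

(* W is a subbimodule of U, and T is isomorphic to U / W: T is the image of U
   under a homomorphism of kernel W. *)
Definition is_quotient V (W U : {vspace V}) T : Prop :=
  stable W /\ (W <= U)%VS /\
  exists (sU : stable U) (f : 'Hom(sub_bimod sU, T)),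
    [/\ bimod_hom f, limg f = fullv
      & forall u, (f u == 0) = (vsval u \in W)].

Definition composition_series V (l : nat) (c : nat -> {vspace V}) : Prop :=
  [/\ c 0%N = 0%VS, c l = fullv &
    forall p, (p < l)%N ->
      exists T, is_quotient (c p) (c p.+1) T /\ simple_bimod T].

Definition composition_factor V T : Prop :=
  exists (l : nat) (c : nat -> {vspace V}) (p : nat),
    [/\ composition_series l c, (p < l)%N & is_quotient (c p) (c p.+1) T].

Definition homogeneous V S : Prop :=
  forall T, composition_factor V T -> bimod_iso T S.

Section RowBimodule.
Variables (n : nat) (A : {rmorphism K -> 'M[F]_n}).
Hypothesis A_central : forall a, A (iK a) = (iF a)%:M.

Definition row_ract (v : 'rV[F]_n) (x : K) : 'rV[F]_n := v *m A x.

Fact row_ract_linear x : linear (row_ract^~ x).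
Proof. by move=> a u v; rewrite /row_ract mulmxDl scalemxAl. Qed.

Fact row_ractD v x y : row_ract v (x + y) = row_ract v x + row_ract v y.
Proof. by rewrite /row_ract rmorphD mulmxDr. Qed.

Fact row_ract1 v : row_ract v 1 = v.
Proof. by rewrite /row_ract rmorph1 mulmx1. Qed.

Fact row_ractM v x y : row_ract v (x * y) = row_ract (row_ract v x) y.
Proof. by rewrite /row_ract rmorphM mulmxA. Qed.

Fact row_ract_central v a : row_ract v (iK a) = iF a *: v.
Proof. by rewrite /row_ract A_central mul_mx_scalar. Qed.

Definition row_bimod : bimod iF iK :=
  @Bimod k F K iF iK 'rV[F]_n row_ract
    row_ract_linear row_ractD row_ract1 row_ractM row_ract_central.

End RowBimodule.

End Bimodules.
Arguments ractr {k F K iF iK} V x v.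
Arguments stable {k F K iF iK} V U.

Section ScalarExtension.
Variables (k K F : fieldType) (i : {rmorphism k -> K}) (j : {rmorphism K -> F}).

Section Rows.
Variables (n : nat) (phi : {rmorphism K -> 'M[K]_n}).
Hypothesis phi_central : forall a, phi (i a) = (i a)%:M.

Definition ext_mx : {rmorphism K -> 'M[F]_n} := map_mx j \o phi.

Fact ext_mx_central a : ext_mx (i a) = ((j \o i) a)%:M.
Proof. by rewrite /= phi_central map_scalar_mx. Qed.

(* F^n, with (f (x) x) . v = f v phi(x) *)
Definition ext_row_bimod : bimod (j \o i) i := row_bimod ext_mx_central.

End Rows.

Section BaseChange.
Variable S : two_sided i.

Let e := vbasis {:S}.

(* F (x)_K S, as the F-space of coordinates in a K-basis e of S; see tens and
   base_change_universal below. *)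
Definition bc_mx (x : K) : 'M[K]_(\dim {:S}) :=
  mxof e e (linfun (ractr S x)).

Definition bc_ract (v : 'rV[F]_(\dim {:S})) (x : K) : 'rV[F]_(\dim {:S}) :=
  v *m map_mx j (bc_mx x).

Let eB : basis_of {:S} e := vbasisP _.

Fact bc_mxD x y : bc_mx (x + y) = bc_mx x + bc_mx y.
Proof.
rewrite /bc_mx -linearD; congr (mxof _ _); apply/lfunP => v.
by rewrite add_lfunE !lfunE /= /ractr ractD.
Qed.

Fact bc_mx1 : bc_mx 1 = 1%:M.
Proof.
rewrite -(mxof1 (basis_free eB)); congr (mxof _ _); apply/lfunP => v.
by rewrite !lfunE /= /ractr ract1.
Qed.

Fact bc_mxM x y : bc_mx (x * y) = bc_mx x *m bc_mx y.
Proof.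
rewrite -mxof_comp //; congr (mxof _ _); apply/lfunP => v.
by rewrite comp_lfunE !lfunE /= /ractr ractM.
Qed.

Fact bc_mx_central a : bc_mx (i a) = (i a)%:M.
Proof.
rewrite -scalemx1 -(mxof1 (basis_free eB)) -linearZ; congr (mxof _ _).
by apply/lfunP => v; rewrite scale_lfunE !lfunE /= /ractr ract_central.
Qed.

Fact bc_ract_linear x : linear (bc_ract^~ x).
Proof. by move=> a u v; rewrite /bc_ract mulmxDl scalemxAl. Qed.

Fact bc_ractD v x y : bc_ract v (x + y) = bc_ract v x + bc_ract v y.
Proof. by rewrite /bc_ract bc_mxD map_mxD mulmxDr. Qed.

Fact bc_ract1 v : bc_ract v 1 = v.
Proof. by rewrite /bc_ract bc_mx1 map_mx1 mulmx1. Qed.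

Fact bc_ractM v x y : bc_ract v (x * y) = bc_ract (bc_ract v x) y.
Proof. by rewrite /bc_ract bc_mxM map_mxM mulmxA. Qed.

Fact bc_ract_central v a : bc_ract v (i a) = (j \o i) a *: v.
Proof. by rewrite /bc_ract bc_mx_central map_scalar_mx mul_mx_scalar. Qed.

Definition base_change : bimod (j \o i) i :=
  @Bimod k F K (j \o i) i 'rV[F]_(\dim {:S}) bc_ract
    bc_ract_linear bc_ractD bc_ract1 bc_ractM bc_ract_central.

(* the pure tensor f (x) s *)
Definition tens (f : F) (s : S) : base_change := f *: map_mx j (rVof e s).

Lemma tensDl f g s : tens (f + g) s = tens f s + tens g s.
Proof. exact: scalerDl. Qed.

Lemma tensDr f s t : tens f (s + t) = tens f s + tens f t.
Proof. by rewrite /tens linearD map_mxD scalerDr. Qed.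

Lemma tensZ f a s : tens (f * j a) s = tens f (a *: s).
Proof. by rewrite /tens linearZ map_mxZ scalerA. Qed.

Lemma ract_tens f s x : ract base_change (tens f s) x = tens f (ract S s x).
Proof.
rewrite /= /bc_ract /tens -scalemxAl -map_mxM /bc_mx mul_mxof rVofK //.
by rewrite lfunE.
Qed.

Lemma base_change_universal (W : lmodType F) (g : S -> W) :
    (forall a s t, g (a *: s + t) = j a *: g s + g t) ->
  exists h : {linear base_change -> W},
    (forall f s, h (tens f s) = f *: g s) /\
    (forall h' : {linear base_change -> W},
       (forall f s, h' (tens f s) = f *: g s) -> h' =1 h).
Proof.
move=> gP.
have g0 : g 0 = 0.
  by have := gP (-1) 0 0; rewrite scaler0 addr0 rmorphN1 scaleN1r addNr.
pose h0 (v : base_change) : W := \sum_p (v : 'rV_ _) 0 p *: g e`_p.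
have h0P : linear h0.
  move=> a u v; rewrite /h0 scaler_sumr -big_split; apply: eq_bigr => p _.
  by rewrite !mxE scalerDl scalerA.
have gE s : g s = \sum_p j (coord e p s) *: g e`_p.
  rewrite {1}(coord_vbasis (memvf s)) -/e.
  have gD u v : g (u + v) = g u + g v.
    by have := gP 1 u v; rewrite rmorph1 !scale1r.
  rewrite (big_morph g gD g0); apply: eq_bigr => p _.
  by have := gP (coord e p s) e`_p 0; rewrite !addr0 g0 addr0.
pose hm := GRing.isLinear.Build F base_change W *:%R h0 h0P.
pose h : {linear base_change -> W} := HB.pack h0 hm.
exists h; split=> [f s | h' h'P v].
  rewrite gE scaler_sumr; apply: eq_bigr => p _.
  by rewrite !mxE scalerA.
have -> : v = \sum_p tens ((v : 'rV_ _) 0 p) e`_p.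
  rewrite [LHS](row_sum_delta (v : 'rV_ _)); apply: eq_bigr => p _.
  by rewrite /tens rVofE // map_delta_mx.
rewrite !linear_sum; apply: eq_bigr => p _; rewrite h'P.
rewrite gE scaler_sumr; apply: eq_bigr => q _.
by rewrite !mxE scalerA.
Qed.

End BaseChange.

End ScalarExtension.

(* The strictly increasing maps f index the standard basis
   e_(f 0) /\ ... /\ e_(f (m-1)) of the m-th exterior power of F^n. *)
Definition incr (m n : nat) :=
  {f : {ffun 'I_m -> 'I_n} | [forall a : 'I_m, forall b : 'I_m, (a < b)%N ==> (f a < f b)%N]}.

Definition extpow (F : fieldType) (m n : nat) := {ffun incr m n -> F^o}.

(* u_0 /\ ... /\ u_(m-1): its coordinates in the standard basis are the maximal
   minors of the matrix with rows u_0, ..., u_(m-1). *)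
Definition wedge (F : fieldType) (m n : nat) (u : m.-tuple 'rV[F]_n) :
    extpow F m n :=
  [ffun f : incr m n => \det (\matrix_(a < m, b < m) tnth u a 0 (val f b))].

Definition is_span (F : fieldType) (V : vectType F) (P : V -> Prop)
    (L : {vspace V}) : Prop :=
  (forall v, P v -> v \in L) /\
  (forall L' : {vspace V}, (forall v, P v -> v \in L') -> (L <= L')%VS).

Section FreeRank.
Variables (k K F : fieldType) (i : {rmorphism k -> K}) (j : {rmorphism K -> F}).
Variables (n : nat) (phi : {rmorphism K -> 'M[K]_n}).
Hypothesis phi_central : forall a, phi (i a) = (i a)%:M.

Definition invariant_basis (m : nat) (v : m.-tuple 'rV[K]_n) : Prop :=
  exists U : {vspace 'rV[K]_n},
    [/\ \dim U = m, stable (row_bimod phi_central) U & basis_of U v].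

(* The element r (x) v_0 /\ ... /\ v_(m-1) of F (x)_K (Lambda^m K^n) is read in
   Lambda^m F^n as r *: (v_0 /\ ... /\ v_(m-1)). *)
Definition free_rank_family (m : nat) (M : {vspace 'rV[F]_n}) : Prop :=
  \dim M = m /\
  exists (N : nat) (r : 'I_N -> F) (v : 'I_N -> m.-tuple 'rV[K]_n),
    (forall p, invariant_basis (v p)) /\
    is_span
      (fun w : extpow F m n =>
         exists u : m.-tuple 'rV[F]_n, {subset u <= M} /\ w = wedge u)
      <[\sum_p r p *: wedge (map_tuple (map_mx j) (v p))]>%VS.

End FreeRank.

(* Main.v *)
Require Import Defs.
From Stdlib Require Import Classical.
From mathcomp Require Import all_boot all_order all_algebra all_field.
From mathcomp Require Import fingroup perm.

(* By homogeneity every invariant subspace of dimension m is isomorphic to S, so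
   an element b of F (x)_k K multiplies each v_(i1) /\ ... /\ v_(im) by the
   determinant of its action on F (x)_K S, hence multiplies the Pluecker vector
   of M by the same scalar. Nonzero elements of K therefore stabilise M, and b
   has the same determinant on M and on F (x)_K S. Since K is perfect, the image
   of F (x)_k K in the endomorphisms of F (x)_K S is reduced, so that any b acting
   nontrivially on F (x)_K S has a multiple acting on both modules as a nonzero
   idempotent: comparing det (1 - e), such an idempotent e is nonzero on M too.
   Adding up vectors fixed by such idempotents gives v in M whose annihilator
   kills F (x)_K S, and mapping v b to s b, for s a generator of F (x)_K S, is
   the isomorphism. *)

Set Implicit Arguments.
Unset Strict Implicit.
Unset Printing Implicit Defensive.

Import Order.TTheory GRing.Theory passmx.
Local Open Scope ring_scope.

(** * Pairs of matrix representations *)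

(** Halve the exponent: if x^(N+2) = 0, the power of exponent [(uphalf N).+1] has square zero, since
    twice this exponent is N + 2 or N + 3. Only powers of [x] are assumed reduced, as later just the
    elements of a subalgebra are. *)
Lemma reduced_nilpotent (R : pzRingType) (x : R) (N : nat) :
  (forall d, x ^+ d.+1 ^+ 2 = 0 -> x ^+ d.+1 = 0) -> x ^+ N.+1 = 0 -> x = 0.
Proof.
move=> red; elim/ltn_ind: N => -[|N] IHN xN0; first by rewrite -[x]expr1.
have Ndouble : (N + odd N = (uphalf N).*2)%N.
  by rewrite uphalf_half doubleD -{1}(odd_double_half N) addnAC addnn.
apply: (IHN (uphalf N)).
  by rewrite ltnS uphalf_half -{3}(odd_double_half N) -addnn leq_add2l leq_addr.
apply: red; rewrite -exprM muln2 doubleS -Ndouble -!addSn exprD xN0.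
exact: mul0r.
Qed.

Section IntertwiningPairs.
Variables (F : fieldType) (m : nat).
Local Notation Mx := 'M[F]_m.+1.
Implicit Types (a b : Mx * Mx).

Lemma horner_alg_pair a p :
  horner_alg a p = (horner_mx a.1 p, horner_mx a.2 p).
Proof.
elim/poly_ind: p => [|p c IHp]; first by rewrite !rmorph0.
rewrite !rmorphD !rmorphM /= horner_algX horner_algC !horner_mx_X !horner_mx_C.
by rewrite IHp; congr pair; rewrite /= scalemx1.
Qed.

(** [R] models the image of F (x)_k K acting at once on F (x)_K S (first component) and on M (second
    component). *)
Variable R : {vspace Mx * Mx}.
Hypothesis R1 : 1 \in R.
Hypothesis RM : {in R &, forall a b, a * b \in R}.
Hypothesis RC : {in R &, forall a b, a * b = b * a}.
Hypothesis Rdet : {in R, forall a, \det a.1 = \det a.2}.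
Hypothesis Rred : {in R, forall a, a.1 ^+ 2 = 0 -> a.1 = 0}.

Lemma pair_horner_in a p : a \in R -> horner_alg a p \in R.
Proof.
move=> aR; elim/poly_ind: p => [|p c IHp]; first by rewrite rmorph0 mem0v.
rewrite !rmorphD !rmorphM /= horner_algX horner_algC.
by rewrite memvD ?RM // memvZ.
Qed.

(** Fitting decomposition: a polynomial killing [a] is written as g X^(N+1) with g prime to X, and a
    Bezout relation between the two factors splits 1 into orthogonal idempotents of F[a]. The one
    divisible by [a] is [e]. *)
Lemma pair_idempotent a : a \in R -> a.1 != 0 ->
  exists e, [/\ e \in R, e * e = e, e != 0 & e.2 != 0]
            /\ exists2 c, c \in R & e = a * c.
Proof.
move=> aR a1N0.
(* The factor ['X] makes 0 a root, so X has positive multiplicity in [f] and [e] will be a multiple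
   of [a]. *)
pose f := 'X * (char_poly a.1 * char_poly a.2).
have f0 : f != 0 by rewrite !mulf_neq0 ?polyX_eq0 ?monic_neq0 ?char_poly_monic.
have fa : horner_alg a f = 0.
  rewrite horner_alg_pair !rmorphM /= !Cayley_Hamilton.
  by rewrite ?(mulr0, mul0r).
have [N [g g0 Ef]] := multiplicity_XsubC f 0.
rewrite f0 /= in g0; rewrite subr0 in Ef.
case: N => [|N] in Ef.
  by move: g0; rewrite expr0 mulr1 in Ef; rewrite -Ef /f rootM rootX eqxx.
have : coprimep ('X^(N.+1)) g.
  by rewrite coprimep_expl // coprimep_sym coprimepX.
case/Bezout_eq1_coprimepP=> -[u1 u2] /= uE.
have uEa : horner_alg a (u1 * 'X^(N.+1)) + horner_alg a (u2 * g) = 1.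
  by rewrite -rmorphD uE rmorph1.
have e0 : horner_alg a (u1 * 'X^(N.+1)) * horner_alg a (u2 * g) = 0.
  rewrite -rmorphM mulrACA [_ * g]mulrC -Ef rmorphM [X in _ * X]fa.
  exact: mulr0.
set e := horner_alg a _ in uEa e0.
have eR : e \in R by apply: pair_horner_in.
(* If [e.1] were 0, multiplying the Bezout relation by X^(N+1) would show that [a.1] is nilpotent,
   hence zero by [Rred]. *)
have e1N0 : e.1 != 0.
  apply: contra a1N0 => /eqP e1.
  apply/eqP; apply: (@reduced_nilpotent _ _ N) => [d|].
    have := @Rred (a ^+ d.+1).
    have -> : (a ^+ d.+1).1 = a.1 ^+ d.+1.
      by elim: d => // d IHd; rewrite !(exprS _ d.+1) /= IHd.
    apply; elim: d => [|d IHd]; first by rewrite expr1.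
    by rewrite exprS RM.
  have aN : a.1 ^+ N.+1 = (horner_alg a 'X^(N.+1)).1.
    by rewrite horner_alg_pair /= rmorphXn /= horner_mx_X.
  rewrite aN -['X^(N.+1)]mulr1 -uE mulrDr rmorphD /=.
  rewrite [_ * (u1 * _)]mulrC rmorphM /= -/e e1 mul0r add0r.
  rewrite mulrCA [_ * g]mulrC -Ef rmorphM /= fa.
  by rewrite mulr0.
exists e; split; last first.
  exists (horner_alg a (u1 * 'X^N)); first exact: pair_horner_in.
  by rewrite -[X in X * _](horner_algX a) -rmorphM mulrCA -exprS.
have ee : e * e = e.
  by rewrite -[RHS]mulr1 -uEa mulrDr e0 addr0.
split=> //; first by apply: contra e1N0 => /eqP ->.
(* If [e.2] were 0, then 1 - [e.1] would have determinant 1, so be invertible, while [e.1] times it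
   is 0. *)
apply: contra e1N0 => /eqP e2.
have := @Rdet (1 - e) (rpredB R1 eR); rewrite /= e2 subr0 det1 => det1e.
have u1e : 1 - e.1 \in unitmx by rewrite unitmxE det1e unitr1.
have : e.1 *m (1 - e.1) = 0.
  have ee1 : e.1 * e.1 = e.1 := congr1 fst ee.
  by rewrite mulmxBr mulmx1 [_ *m _]ee1 subrr.
by move/(congr1 (mulmx^~ (invmx (1 - e.1)))); rewrite mulmxK // mul0mx => ->.
Qed.

Definition ann (v : 'rV[F]_m.+1) : {vspace Mx * Mx} :=
  (R :&: lker (linfun (mulmx v \o snd)))%VS.

Lemma mem_ann v a : (a \in ann v) = (a \in R) && (v *m a.2 == 0).
Proof. by rewrite memv_cap memv_ker lfunE. Qed.

(* If a in R kills v but a.1 <> 0, then a multiple e of a is a nonzero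
   idempotent; adding to v a vector fixed by e and not killed by it shrinks
   the annihilator. *)
Lemma pair_separating_vector :
  exists v : 'rV_m.+1, {in R, forall a, v *m a.2 = 0 -> a.1 = 0}.
Proof.
suff: forall d v, (\dim (ann v) <= d)%N ->
    exists v : 'rV_m.+1, {in R, forall a, v *m a.2 = 0 -> a.1 = 0}.
  by move/(_ _ 0 (leqnn _)).
elim=> [|d IHd] v dv.
  exists v => a aR va; have: a \in ann v by rewrite mem_ann aR va eqxx.
  by move: dv; rewrite leqn0 dimv_eq0 => /eqP ->; rewrite memv0 => /eqP ->.
have [/subvP vP|/subvPn[a]] := boolP (ann v <= lker (linfun fst))%VS.
  exists v => a aR va; have := vP a; rewrite mem_ann aR va eqxx memv_ker lfunE.
  by move=> /(_ isT)/eqP.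
rewrite mem_ann memv_ker lfunE => /andP[aR /eqP va] a1N0.
have [e [[eR ee eN0 e2N0] [c cR Ee]]] := pair_idempotent aR a1N0.
have e2e2 : e.2 *m e.2 = e.2 by have := congr1 snd ee.
have ve : v *m e.2 = 0 by rewrite Ee /= mulmxA va mul0mx.
have [i ri] : exists i, row i e.2 != 0.
  apply/existsP; apply: contraR e2N0 => /existsPn h.
  apply/eqP/row_matrixP => i; rewrite row0; apply/eqP.
  by have := h i; rewrite negbK.
pose w := row i e.2.
have we : w *m e.2 = w by rewrite /w -row_mul e2e2.
apply: (IHd (v + w)); rewrite -ltnS; apply: leq_trans dv.
have sub : (ann (v + w) <= ann v)%VS.
  apply/subvP => b; rewrite !mem_ann => /andP[bR /eqP vwb]; rewrite bR /=.
  have eb : b.2 *m e.2 = e.2 *m b.2 by have := congr1 snd (RC bR eR).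
  have : (v + w) *m b.2 *m e.2 = 0 by rewrite vwb mul0mx.
  rewrite -mulmxA eb mulmxA mulmxDl ve add0r we => wb.
  by move: vwb; rewrite mulmxDl wb addr0 => ->.
rewrite ltn_neqAle dimvS // andbT; apply: contra ri => /eqP dimE.
have : e \in ann v by rewrite mem_ann eR ve eqxx.
have /eqP <- : ann (v + w) == ann v by rewrite eqEdim sub dimE leqnn.
by rewrite mem_ann eR mulmxDl ve add0r we.
Qed.

(** [Y] sends s a.1 to v a.2, where [v] is the separating vector. The linear section [comb] picks
    one [a] for each s a.1; [Y] is injective because [comb u] killing [v] forces its first
    component, hence [u], to vanish. *)
Lemma pair_intertwiner (s : 'rV[F]_m.+1) :
    (forall t, exists2 a, a \in R & t = s *m a.1) ->
  exists2 Y : Mx, Y \in unitmx & {in R, forall a, Y *m a.2 = a.1 *m Y}.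
Proof.
move=> sP; have [v vP] := pair_separating_vector.
have [b bP] : exists b : 'I_m.+1 -> Mx * Mx,
    forall i, b i \in R /\ s *m (b i).1 = delta_mx 0 i.
  apply: (@fin_all_exists _ _ (fun i c => c \in R /\ s *m c.1 = delta_mx 0 i)).
  by move=> i; have [a aR ->] := sP (delta_mx 0 i); exists a.
pose Y := \matrix_i (v *m (b i).2).
pose comb (u : 'rV[F]_m.+1) := \sum_i u 0 i *: b i.
have combR u : comb u \in R.
  by apply: rpred_sum => i _; rewrite memvZ //; case: (bP i).
have scomb u : s *m (comb u).1 = u.
  rewrite [RHS]row_sum_delta /comb (raddf_sum fst) mulmx_sumr /=.
  by apply: eq_bigr => i _; rewrite -scalemxAr; have [_ ->] := bP i.
have vcomb u : v *m (comb u).2 = u *m Y.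
  rewrite [RHS]mulmx_sum_row /comb (raddf_sum snd) mulmx_sumr /=.
  by apply: eq_bigr => i _; rewrite -scalemxAr rowK.
have Yu : Y \in unitmx.
  rewrite -row_free_unit -kermx_eq0; apply/rowV0P => u /sub_kermxP uY.
  by rewrite -[u]scomb (vP (comb u)) ?vcomb ?mulmx0.
exists Y => // a aR; apply/row_matrixP => i.
rewrite !row_mul rowK.
(* The intertwining relation on row [i] amounts to v d.2 = 0. Since s d.1 = 0 and [s] generates,
   commutativity gives d.1 = 0. *)
pose d := b i * a - comb (row i a.1).
have [biR sbi] := bP i.
have dR : d \in R by rewrite memvB ?RM.
have sd : s *m d.1 = 0.
  rewrite /= mulmxBr scomb [_ * _](_ : _ = (b i).1 *m a.1) // mulmxA sbi.
  by rewrite -rowE subrr.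
have d1 : d.1 = 0.
  apply/row_matrixP => l; rewrite row0 rowE.
  have [c cR ->] := sP (delta_mx 0 l).
  have dc : c.1 *m d.1 = d.1 *m c.1 by have := congr1 fst (RC cR dR).
  by rewrite -mulmxA dc mulmxA sd mul0mx.
(* As [Y] is onto, v d.2 is also the image of [v] under some [comb u]. Then [d - comb u] kills [v],
   so its first component is 0; applying it to [s] gives u = 0. *)
have [u uE] : exists u, v *m d.2 = u *m Y.
  by exists (v *m d.2 *m invmx Y); rewrite mulmxKV.
have dcR : d - comb u \in R by rewrite memvB.
have u0 : u = 0.
  have vdc : v *m (d.2 - (comb u).2) = 0 by rewrite mulmxBr vcomb uE subrr.
  have /(congr1 (mulmx s)) : d.1 - (comb u).1 = 0 := vP _ dcR vdc.
  rewrite mulmxBr sd scomb mulmx0 add0r.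
  by move/eqP; rewrite oppr_eq0 => /eqP.
have : v *m d.2 = 0 by rewrite uE u0 mul0mx.
rewrite /= mulmxBr vcomb [_ * _](_ : _ = (b i).2 *m a.2) // mulmxA.
by move=> /eqP; rewrite subr_eq0 => /eqP.
Qed.

End IntertwiningPairs.

(** * Reducedness over a perfect field *)

Lemma exists_irreducible_factor (K : fieldType) (f : {poly K}) :
  (1 < size f)%N -> exists2 q, irreducible_poly q & q %| f.
Proof.
elim/ltn_ind: {f}(size f) {-2}f (erefl (size f)) => N IHN f sf f1.
have [firr|] := classic (irreducible_poly f); first by exists f.
move=> nirr; have f0 : f != 0 by rewrite -size_poly_gt0 ltnW.
have [g [g1 gf ngf]] : exists g : {poly K},
    [/\ size g != 1%N, g %| f & ~~ (g %= f)].
  apply: NNPP => none; apply: nirr; split=> [|g g1 gf]; first by [].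
  by apply: contraT => ngf; exfalso; apply: none; exists g.
have g0 : g != 0
  by apply: contraNneq f0 => g0; move: gf; rewrite g0 dvd0p.
have gN : (size g < N)%N.
  rewrite -sf ltn_neqAle dvdp_leq // andbT.
  by apply: contra ngf ; rewrite dvdp_size_eqp.
have g2 : (1 < size g)%N by rewrite ltn_neqAle eq_sym g1 size_poly_gt0.
have [q qirr qg] := IHN _ gN g erefl g2.
by exists q => //; apply: dvdp_trans gf.
Qed.

(* If q^e exactly divides X^p - a with q irreducible, then differentiating
   gives e = 0 in K, because q is prime to q'; so p <= e and q is linear. *)
Lemma perfect_pchar_root (K : fieldType) (p : nat) (a : K) :
  perfect_field K -> p \in [pchar K] -> exists d, d ^+ p = a.
Proof.
move=> perf pK; have p_gt0 : (0 < p)%N by rewrite prime_gt0 ?(pcharf_prime pK).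
pose f : {poly K} := 'X^p - a%:P.
have sf : size f = p.+1 by rewrite size_XnsubC.
have f0 : f != 0 by rewrite -size_poly_gt0 sf.
have [|q qirr qf] := @exists_irreducible_factor _ f; first by rewrite sf ltnS.
have q1 : (1 < size q)%N by case: qirr.
have e1P : exists e, q ^+ e %| f by exists 0; rewrite expr0 dvd1p.
have sqe e : size (q ^+ e) = ((size q).-1 * e).+1.
  by rewrite -size_exp prednK // size_poly_gt0 expf_neq0 ?irredp_neq0.
have e_bound e : q ^+ e %| f -> (e <= p)%N.
  move=> /(dvdp_leq f0); rewrite sqe sf ltnS; apply: leq_trans.
  by rewrite leq_pmull // -subn1 subn_gt0.
case: (ex_maxnP e1P e_bound) => e ef emax.
have e_gt0 : (0 < e)%N by rewrite emax ?expr1.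
have /dvdpP[r Ef] := ef.
have rq : coprimep q r.
  rewrite irreducible_poly_coprime //; apply/negP => qr.
  suff : (e.+1 <= e)%N by rewrite ltnn.
  by rewrite emax // Ef exprS dvdp_mul.
have f'0 : f^`() = 0.
  rewrite derivB derivC derivXn subr0 -mulr_natr pcharf0 ?mulr0 //.
  by rewrite (pchar_lalg _ p).
have qe0 : e%:R = 0 :> K.
  have Edf : (r^`() * q + r * q^`() *+ e) * q ^+ e.-1 = 0.
    rewrite -f'0 Ef derivM deriv_exp mulrDl -mulrA -exprS prednK //.
    by rewrite mulrnAr mulrnAl mulrA.
  have {Edf} : r^`() * q + r * q^`() *+ e = 0.
    apply/eqP; move/eqP: Edf; rewrite mulf_eq0 expf_eq0.
    by rewrite (negPf (irredp_neq0 qirr)) andbF orbF.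
  move/eqP; rewrite addrC addr_eq0 -mulr_natr -mulNr => /eqP Eq.
  have : q %| r * q^`() * e%:R by rewrite Eq dvdp_mull.
  rewrite -mulrA Gauss_dvdpr // Gauss_dvdpr; last first.
    by have := perf q qirr; rewrite unlock.
  rewrite -polyC_natr => qe; apply/eqP; apply: contraT => e0.
  have := dvdp_leq _ qe.
  by rewrite polyC_eq0 e0 size_polyC e0 leqNgt q1 => /(_ isT).
have pe : (p <= e)%N by rewrite dvdn_leq // (dvdn_pcharf pK) qe0.
have sq : size q = 2%N.
  apply/eqP; rewrite eqn_leq q1 andbT.
  have := dvdp_leq f0 ef; rewrite sqe sf ltnS => /leq_trans/(_ pe).
  by rewrite -{2}[e]mul1n leq_pmul2r // -subn1 leq_subLR.
have [d qd] := poly2_root sq.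
have : root f d by move: qd; rewrite -!dvdp_XsubCl => /dvdp_trans->.
rewrite rootE !hornerE subr_eq0 => /eqP dp; exists d.
by rewrite -dp.
Qed.

(** Rank factorization A = X Y, with X left invertible and Y right invertible: A^2 = 0 forces Y X =
    0, and tr (X Y) = tr (Y X). *)
Lemma mxtrace_square_zero (F : fieldType) (n : nat) (A : 'M[F]_n) :
  A *m A = 0 -> \tr A = 0.
Proof.
rewrite -{1 2 3}[A]mulmx_base mxtrace_mulC => A0.
suff -> : row_base A *m col_base A = 0 by rewrite mxtrace0.
have [B AB] := row_freeP (row_base_free A).
have /row_fullP[C CA] := col_base_full A.
move: (col_base A) (row_base A) A0 AB CA => X Y XYXY YB CX.
have : C *m (X *m Y *m (X *m Y)) *m B = 0 by rewrite XYXY mulmx0 mul0mx.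
by rewrite !mulmxA CX mul1mx -!mulmxA YB mulmx1.
Qed.

Section SpanReduced.
Variables (K F : fieldType) (j : {rmorphism K -> F}) (m : nat).
(** [L] models the image of K (x)_k K in the endomorphisms of S, a field by Schur's lemma. *)
Variable L : {vspace 'M[K]_m.+1}.
Hypothesis K_perfect : perfect_field K.
Hypothesis L1 : 1 \in L.
Hypothesis LM : {in L &, forall a b, a * b \in L}.
Hypothesis LC : {in L &, forall a b, a * b = b * a}.
Hypothesis Lunit : {in L, forall a, a != 0 -> a \in unitmx}.

(** Multiplication by [a] maps [L] injectively into itself, hence onto by dimension, so it reaches
    1. *)
Lemma span_inverse a : a \in L -> a != 0 -> exists2 b, b \in L & a * b = 1.
Proof.
move=> aL a0; have au := Lunit aL a0.
pose f := linfun (mulmx a : 'M[K]_m.+1 -> 'M[K]_m.+1).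
have sub : (f @: L <= L)%VS.
  by apply/subvP => _ /memv_imgP[b bL ->]; rewrite lfunE; apply: LM.
have ker0 : (L :&: lker f = 0)%VS.
  apply/eqP; rewrite -subv0; apply/subvP => b.
  rewrite memv_cap memv_ker lfunE memv0 => /andP[_ /eqP ab].
  by rewrite -[b](mulKmx au) [a *m b]ab mulmx0.
have /eqP fL : (f @: L == L)%VS by rewrite eqEdim sub limg_dim_eq //= leqnn.
have : 1 \in (f @: L)%VS by rewrite fL.
by case/memv_imgP=> b bL; rewrite lfunE => ->; exists b.
Qed.

Let e := vbasis L.

(* If m.+1 is nonzero in K, the trace form of L is nondegenerate, and stays so
   over F. Otherwise the p-th powers of a K-basis of L are K-independent, because
   Frobenius is onto K; hence they are F-independent. *)
Lemma ext_span_reduced (f : 'I_(\dim L) -> F) :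
  let P := \sum_a f a *: map_mx j (e`_a) in P *m P = 0 -> P = 0.
Proof.
move=> P PP.
have eL (a : 'I_(\dim L)) : e`_a \in L.
  by rewrite vbasis_mem ?mem_nth ?size_tuple.
suff f0 a1 : f a1 = 0 by rewrite /P big1 // => a _; rewrite f0 scale0r.
have [mK|mK] := eqVneq (m.+1%:R : K) 0; last first.
  pose G := \matrix_(a < \dim L, b < \dim L) \tr (e`_a *m e`_b).
  have Gfree : row_free G.
    rewrite -kermx_eq0; apply/rowV0P => c /sub_kermxP cG.
    pose l := \sum_a c 0 a *: e`_a.
    have lL : l \in L by apply: rpred_sum => a _; rewrite memvZ.
    have le (b : 'I_(\dim L)) : \tr (l *m e`_b) = 0.
      transitivity ((c *m G) 0 b); last by rewrite cG mxE.
      rewrite mxE mulmx_suml raddf_sum /=; apply: eq_bigr => a _.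
      by rewrite -scalemxAl mxtraceZ mxE.
    have ll b : b \in L -> \tr (l *m b) = 0.
      move/coord_vbasis ->; rewrite mulmx_sumr raddf_sum big1 //= => a _.
      by rewrite -scalemxAr mxtraceZ le mulr0.
    have l0 : l = 0.
      apply/eqP; apply: contraT => l0; have [b bL lb] := span_inverse lL l0.
      have := ll b bL; rewrite [l *m b]lb mxtrace1 => /eqP.
      by rewrite (negPf mK).
    apply/rowP => a; rewrite mxE.
    by have /freeP := basis_free (vbasisP L); apply.
  pose fr := \row_a f a.
  (* Each entry is the trace of P e_b, which squares to zero because [P] commutes with e_b. *)
  have : fr *m map_mx j G = 0.
    apply/rowP => b; rewrite !mxE.
    transitivity (\tr (P *m map_mx j (e`_b))).
      rewrite mulmx_suml raddf_sum /=; apply: eq_bigr => a _.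
      by rewrite -scalemxAl mxtraceZ !mxE -map_mxM trace_map_mx.
    apply: mxtrace_square_zero.
    have PeC : P *m map_mx j e`_b = map_mx j e`_b *m P.
      rewrite mulmx_suml mulmx_sumr; apply: eq_bigr => a _.
      rewrite -scalemxAl -scalemxAr -!map_mxM; congr (_ *: map_mx j _).
      exact: LC.
    by rewrite mulmxA -[P *m _ *m P]mulmxA -PeC !mulmxA PP !mul0mx.
  move/eqP; rewrite mulmx_free_eq0 ?row_free_map // => /eqP fr0.
  by have := congr1 (fun u : 'rV_ _ => u 0 a1) fr0; rewrite !mxE.
have [p pK] : exists p, p \in [pchar K].
  by apply: (@natf0_pchar _ m.+1) => //; apply/eqP.
have pMK : p \in [pchar 'M[K]_m.+1] by rewrite pchar_lalg.
have pMF : p \in [pchar 'M[F]_m.+1] by rewrite pchar_lalg (rmorph_pchar j).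
have p_prime := pcharf_prime pK.
pose N := \matrix_(a < \dim L) mxvec (e`_a ^+ p).
have sumXp (E : fieldType) (I : finType) (c : I -> E) (X : I -> 'M[E]_m.+1) :
    p \in [pchar 'M[E]_m.+1] -> (forall a b, X a * X b = X b * X a) ->
  (\sum_a c a *: X a) ^+ p = \sum_a c a ^+ p *: X a ^+ p.
  move=> pE XC; elim: (index_enum I) => [|a r IHr].
    by rewrite !big_nil expr0n -(prednK (prime_gt0 p_prime)).
  rewrite !big_cons -IHr -(pFrobenius_autE pE) pFrobenius_autD_comm.
    by rewrite !pFrobenius_autE exprZn.
  apply: commr_sum => b _.
  by rewrite /GRing.comm -!scalerAl -!scalerAr XC scalerA mulrC -scalerA.
have Nfree : row_free N.
  rewrite -kermx_eq0; apply/rowV0P => c /sub_kermxP cN.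
  have [d dP] : exists d : 'I_(\dim L) -> K, forall a, d a ^+ p = c 0 a.
    apply: (@fin_all_exists _ _ (fun a x => x ^+ p = c 0 a)) => a.
    exact: perfect_pchar_root.
  pose l := \sum_a d a *: e`_a.
  have lL : l \in L by apply: rpred_sum => a _; rewrite memvZ.
  have lp : l ^+ p = 0.
    rewrite /l sumXp // => [|a b]; last exact: LC.
    apply/eqP; rewrite -mxvec_eq0 -cN mulmx_sum_row linear_sum; apply/eqP.
    by apply: eq_bigr => a _; rewrite linearZ rowK dP.
  have l0 : l = 0.
    apply/eqP; apply: contraT => /(Lunit lL) lu.
    by have := unitrX p lu; rewrite lp unitr0.
  apply/rowP => a; rewrite mxE -dP.
  have /freeP/(_ _ l0) -> := basis_free (vbasisP L).
  by rewrite expr0n -(prednK (prime_gt0 p_prime)).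
pose fr := \row_a (f a ^+ p).
(* This row is P^p flattened, which vanishes since P^2 = 0 and p is at least 2. *)
have : fr *m map_mx j N = 0.
  apply/eqP; rewrite mulmx_sum_row.
  have -> : \sum_a fr 0 a *: row a (map_mx j N) = mxvec (P ^+ p).
    rewrite sumXp // => [|a b]; last first.
      by rewrite -[LHS]map_mxM -[RHS]map_mxM; congr (map_mx j _); apply: LC.
    rewrite linear_sum; apply: eq_bigr => a _.
    by rewrite linearZ mxE -map_row rowK map_mxvec rmorphXn.
  by rewrite mxvec_eq0 -(subnK (prime_gt1 p_prime)) exprD expr2 [P * P]PP mulr0.
move/eqP; rewrite mulmx_free_eq0 ?row_free_map // => /eqP fr0.
have /eqP := congr1 (fun u : 'rV_ _ => u 0 a1) fr0.
by rewrite !mxE expf_eq0 => /andP[_ /eqP].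
Qed.
End SpanReduced.

(** * Algebras spanned by commuting matrices, and the intertwiner they give *)

Lemma finite_spanning_seq (F : fieldType) (V : vectType F) (P : V -> Prop) :
  exists s : seq V,
    {in s, forall v, P v} /\ (forall v, P v -> v \in <<s>>%VS).
Proof.
(* [d] bounds how many independent vectors can still be added to [s]. *)
suff: forall d (s : seq V), (\dim {:V} <= d + \dim <<s>>)%N ->
    {in s, forall v, P v} ->
    exists s : seq V,
      {in s, forall v, P v} /\ (forall v, P v -> v \in <<s>>%VS).
  by move/(_ _ [::] (leq_addr _ _)); apply.
elim=> [|d IHd] s ds sP.
  exists s; split=> // v _; have /eqP -> : (<<s>> == fullv)%VS.
    by rewrite eqEdim subvf.
  exact: memvf.
have [?|] := classic (forall v, P v -> v \in <<s>>%VS); first by exists s.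
move=> /not_all_ex_not[v] nPv.
have [Pv vs] : P v /\ ~ v \in <<s>>%VS by apply: imply_to_and.
apply: (IHd (v :: s)); last by move=> w; rewrite inE => /predU1P[->|/sP].
apply: leq_trans ds _; rewrite addSnnS leq_add2l ltnNge.
apply/negP => dim_le; apply: vs.
have sub : (<<s>> <= <<v :: s>>)%VS by rewrite span_cons addvSr.
have /eqP -> : (<<s>> == <<v :: s>>)%VS by rewrite eqEdim sub.
by rewrite span_cons (subvP (addvSl _ _)) // memv_line.
Qed.

Lemma span_ind (F : fieldType) (V : vectType F) (s : seq V) (P : V -> Prop) :
    P 0 -> (forall u v, P u -> P v -> P (u + v)) ->
    (forall c u, P u -> P (c *: u)) -> {in s, forall v, P v} ->
  {in <<s>>%VS, forall v, P v}.
Proof.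
move=> P0 PD PZ Ps v /(@coord_span _ _ _ (in_tuple s)) ->.
apply: (big_ind P) => // i _; apply: PZ; apply: Ps.
by rewrite mem_nth // -[size s]/(size (in_tuple s)) size_tuple.
Qed.

Section SpanPairs.
Variables (K F : fieldType) (j : {rmorphism K -> F}) (m : nat).
Variables (T : K -> 'M[K]_m.+1) (A : K -> 'M[F]_m.+1).
Hypothesis K_perfect : perfect_field K.
Hypothesis T1 : T 1 = 1%:M.
Hypothesis TM : forall x y, T (x * y) = T x *m T y.
Hypothesis A1 : A 1 = 1%:M.
Hypothesis AM : forall x y, A (x * y) = A x *m A y.
Hypothesis T_irr : forall U : 'M[K]_m.+1,
  (forall x, (U *m T x <= U)%MS) -> U = 0 \/ row_full U.
Hypothesis det_eq : forall N (c : 'I_N -> F) (x : 'I_N -> K),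
  \det (\sum_p c p *: map_mx j (T (x p))) = \det (\sum_p c p *: A (x p)).

(** [T] is the action on S and [A] the action on M. The span [L] of the [T x] and the span [R] of
    the pairs are shown to meet the hypotheses of [ext_span_reduced] and [pair_intertwiner]. *)
Lemma simple_intertwiner_succ :
  exists2 Y : 'M[F]_m.+1, Y \in unitmx &
    forall x, Y *m A x = map_mx j (T x) *m Y.
Proof.
have [sT [sTP sTspan]] := finite_spanning_seq (fun a => exists x, a = T x).
pose L := <<sT>>%VS.
have TL x : T x \in L by apply: sTspan; exists x.
have L1 : 1 \in L by rewrite -[1]T1.
have LT a x : a \in L -> a *m T x = T x *m a /\ a *m T x \in L.
  move: a; apply: span_ind => [|a b [aC aL] [bC bL]|c a [aC aL]|_ /sTP[y ->]].
  - by rewrite mulmx0 mul0mx mem0v.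
  - by rewrite mulmxDl mulmxDr aC bC memvD -?aC -?bC.
  - by rewrite -scalemxAl -scalemxAr aC memvZ -?aC.
  - by rewrite -!TM mulrC.
have LML : {in L &, forall a b, a * b = b * a /\ a * b \in L}.
  move=> a b aL; move: b.
  apply: span_ind => [|b b' [bC bL] [b'C b'L]|c b [bC bL]|_ /sTP[y ->]].
  - by rewrite mulr0 mul0r mem0v.
  - by rewrite mulrDl mulrDr -bC -b'C memvD.
  - by rewrite -scalerAl -scalerAr -bC memvZ.
  - exact: LT.
have LC : {in L &, forall a b, a * b = b * a} by move=> a b aL /(LML _ _ aL)[].
have LM : {in L &, forall a b, a * b \in L} by move=> a b aL /(LML _ _ aL)[].
(* Schur's lemma: the kernel of [a] is invariant because [a] commutes with every [T x]. *)
have Lunit : {in L, forall a, a != 0 -> a \in unitmx}.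
  move=> a aL a0; have [x|k0|kfull] := T_irr (U := kermx a).
  - by apply/sub_kermxP; rewrite -mulmxA -(LT a x aL).1 mulmxA mulmx_ker mul0mx.
  - by rewrite -row_free_unit -kermx_eq0 k0.
  - case/eqP: a0; have [B BK] := row_fullP kfull.
    by rewrite -[a]mul1mx -BK -mulmxA mulmx_ker mulmx0.
pose e := vbasis L.
have [sR [sRP sRspan]] :=
  finite_spanning_seq (fun a : 'M[F]_m.+1 * 'M[F]_m.+1 =>
     exists x, a = (map_mx j (T x), A x)).
pose R := <<sR>>%VS.
have TAR x : (map_mx j (T x), A x) \in R by apply: sRspan; exists x.
have R1 : 1 \in R.
  by rewrite (_ : 1 = (map_mx j (T 1), A 1)) // T1 A1 map_mx1.
have RTA a x (b := (map_mx j (T x), A x)) :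
    a \in R -> a * b = b * a /\ a * b \in R.
  move: a; apply: span_ind => [|a a' [aC aL] [bC bL]|c a [aC aL]|_ /sRP[y ->]].
  - by rewrite mulr0 mul0r mem0v.
  - by rewrite mulrDl mulrDr -aC -bC memvD.
  - by rewrite -scalerAl -scalerAr -aC memvZ.
  - have prodE z w : (map_mx j (T z), A z) * (map_mx j (T w), A w) =
       (map_mx j (T (z * w)), A (z * w)) by rewrite TM AM map_mxM.
    by rewrite /b !prodE mulrC.
have RMR : {in R &, forall a b, a * b = b * a /\ a * b \in R}.
  move=> a b aR; move: b.
  apply: span_ind => [|b b' [bC bR] [b'C b'R]|c b [bC bR]|_ /sRP[y ->]].
  - by rewrite mulr0 mul0r mem0v.
  - by rewrite mulrDl mulrDr -bC -b'C memvD.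
  - by rewrite -scalerAl -scalerAr -bC memvZ.
  - exact: RTA.
have RC : {in R &, forall a b, a * b = b * a} by move=> a b aR /(RMR _ _ aR)[].
have RM : {in R &, forall a b, a * b \in R} by move=> a b aR /(RMR _ _ aR)[].
have Rdet : {in R, forall a, \det a.1 = \det a.2}.
  move=> a aR; have aE := @coord_span _ _ _ (in_tuple sR) _ aR.
  have [x xP] : exists x : 'I_(size sR) -> K,
      forall p : 'I_(size sR), sR`_p = (map_mx j (T (x p)), A (x p)).
    apply: (@fin_all_exists _ _
      (fun (p : 'I_(size sR)) x => sR`_p = (map_mx j (T x), A x))) => p.
    by apply: sRP; rewrite mem_nth.
  rewrite aE (raddf_sum fst) (raddf_sum snd) /=.
  rewrite (eq_bigr (fun p => coord (in_tuple sR) p a *: map_mx j (T (x p)))).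
    rewrite det_eq; congr (\det _); apply: eq_bigr => p _.
    by rewrite xP.
  by move=> p _; rewrite xP.
have R1L : {in R, forall a, exists f : 'I_(\dim L) -> F,
    a.1 = \sum_(p < \dim L) f p *: map_mx j (e`_p)}.
  apply: span_ind => [|a b [f af] [g bg]|c a [f af]|_ /sRP[x ->]].
  - by exists (fun=> 0); rewrite big1 // => p _; rewrite scale0r.
  - exists (fun p => f p + g p); rewrite [LHS]/= af bg -big_split.
    by apply: eq_bigr => p _; rewrite scalerDl.
  - exists (fun p => c * f p); rewrite [LHS]/= af scaler_sumr.
    by apply: eq_bigr => p _; rewrite scalerA.
  - exists (fun p => j (coord e p (T x))).
    rewrite [LHS]/= {1}(coord_vbasis (TL x)).
    rewrite raddf_sum; apply: eq_bigr => p _; exact: map_mxZ.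
have Rred : {in R, forall a, a.1 ^+ 2 = 0 -> a.1 = 0}.
  move=> a /R1L[f ->] ff0.
  apply: (ext_span_reduced K_perfect L1 LM LC Lunit).
  by rewrite -[RHS]ff0 expr2.
have Llift : {in L, forall a, exists2 b, b \in R & b.1 = map_mx j a}.
  apply: span_ind =>
    [|a b [a' aR a'E] [b' bR b'E]|c a [a' aR a'E]|_ /sTP[x ->]].
  - by exists 0; rewrite ?mem0v ?map_mx0.
  - by exists (a' + b'); rewrite ?memvD // map_mxD -a'E -b'E.
  - by exists (j c *: a'); rewrite ?memvZ // map_mxZ -a'E.
  - by exists (map_mx j (T x), A x).
(* Any nonzero vector would do: the row space of [E] is the invariant subspace it generates, so it
   is everything by [T_irr], and remains so over F. *)
pose s : 'rV[K]_m.+1 := delta_mx 0 0.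
pose E := \matrix_(p < \dim L) (s *m e`_p).
have eL (p : 'I_(\dim L)) : e`_p \in L.
  by rewrite vbasis_mem ?mem_nth ?size_tuple.
have sE a : a \in L -> (s *m a <= E)%MS.
  move=> aL; rewrite (coord_vbasis aL) mulmx_sumr; apply: summx_sub => p _.
  by rewrite -scalemxAr scalemx_sub // -(rowK (fun p => s *m e`_p)) row_sub.
have Efull : row_full E.
  have [x|E0|] := T_irr (U := <<E>>%MS).
  - rewrite (eqmxMr _ (genmxE E)) genmxE; apply/row_subP => p.
    by rewrite row_mul rowK -mulmxA sE // (LT _ x (eL p)).2.
  - have := sE 1 L1; rewrite mulmx1 -(genmxE E) E0 submx0.
    move=> /eqP/matrixP/(_ 0 0); rewrite !mxE !eqxx => /eqP.
    by rewrite oner_eq0.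
  - by rewrite /row_full genmxE.
have [t|Y Yu YP] := pair_intertwiner R1 RM RC Rdet Rred (s := map_mx j s).
  have [u] : exists u, t = u *m map_mx j E.
    by apply/submxP; rewrite submx_full // row_full_map.
  have [b bP] : exists b : 'I_(\dim L) -> 'M[F]_m.+1 * 'M[F]_m.+1,
      forall p : 'I_(\dim L), b p \in R /\ (b p).1 = map_mx j e`_p.
    apply: (@fin_all_exists _ _
      (fun (p : 'I_(\dim L)) b => b \in R /\ b.1 = map_mx j e`_p)) => p.
    by have [b bR bE] := Llift _ (eL p); exists b.
  move=> ->; exists (\sum_p u 0 p *: b p).
    by apply: rpred_sum => p _; rewrite memvZ //; case: (bP p).
  rewrite mulmx_sum_row (raddf_sum fst) mulmx_sumr; apply: eq_bigr => p _.
  by rewrite -map_row rowK map_mxM -scalemxAr; have [_ ->] := bP p.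
by exists Y => // x; apply: (YP (map_mx j (T x), A x)) (TAR x).
Qed.

End SpanPairs.

(** * Maximal minors *)

(** Cauchy-Binet before grouping: each column of the product is a combination of columns of [D], and
    [h] records which one is chosen, repetitions included. *)
Lemma det_mulmx_expand (R : comPzRingType) (m n : nat)
    (D : 'M[R]_(m, n)) (Psi : 'M[R]_(n, m)) :
  \det (D *m Psi) =
  \sum_(h : {ffun 'I_m -> 'I_n})
     (\prod_b Psi (h b) b) * \det (\matrix_(a, b) D a (h b)).
Proof.
under eq_bigr do rewrite -det_tr mulr_sumr.
rewrite -det_tr exchange_big /=; apply: eq_bigr => s _.
under eq_bigr do rewrite !mxE.
rewrite bigA_distr_bigA mulr_sumr; apply: eq_bigr => h _.
rewrite mulrCA -big_split; congr (_ * _); apply: eq_bigr => b _.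
by rewrite !mxE mulrC.
Qed.

Lemma incr_factor (m n : nat) (h : 'I_m -> 'I_n) : injective h ->
  exists (f : incr m n) (s : 'S_m), forall b, h b = val f (s b).
Proof.
move=> h_inj; pose t := [tuple h b | b < m].
pose u := sort_tuple <=%O t.
have ut : perm_eq t u by rewrite perm_sym perm_sort.
have [s sE] := tuple_permP ut.
have u_lt : sorted <%O u.
  by rewrite sort_lt_sorted map_inj_uniq // enum_uniq.
have f_incr : [forall a : 'I_m, forall b : 'I_m, (a < b)%N ==>
    ([ffun a => tnth u a] a < [ffun a => tnth u a] b)%N].
  apply/'forall_'forall_implyP => a b ab; rewrite !ffunE.
  rewrite !(tnth_nth (h a)).
  have := lt_sorted_ltn_nth (h a) u_lt (x := a) (y := b).
  by rewrite !inE !size_tuple !ltn_ord ab ltEord => /(_ isT isT).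
exists (Sub [ffun a => tnth u a] f_incr), s => b; rewrite SubK ffunE.
have := congr1 (fun w => nth (h b) w b) sE.
by rewrite -!tnth_nth !tnth_mktuple.
Qed.

(** A repeated column kills the minor; otherwise sorting the columns costs a sign. The alternative,
    [f] and [c] depend on [h] alone, so they serve several matrices at once. *)
Lemma minor_sort (F : fieldType) (m n : nat) (h : 'I_m -> 'I_n) :
  (forall D : 'M[F]_(m, n), \det (\matrix_(a, b) D a (h b)) = 0) \/
  exists (f : incr m n) (c : F), forall D : 'M[F]_(m, n),
    \det (\matrix_(a, b) D a (h b)) = c * \det (\matrix_(a, b) D a (val f b)).
Proof.
have [/injectiveP h_inj|/injectivePn[b [b' bb' hb]]] := boolP (injectiveb h).
  right; have [f [s hE]] := incr_factor h_inj.
  exists f, ((-1) ^+ (s^-1)%g) => D; rewrite mulrC -det_perm -det_mulmx.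
  rewrite -col_permE; congr (\det _).
  by apply/matrixP => a b; rewrite !mxE hE.
left=> D; rewrite -det_tr; apply: (determinant_alternate bb') => a.
by rewrite !mxE hb.
Qed.

(** The determinant of D Psi is linear in the Pluecker coordinates of [D]. A relation in the
    exterior power thus becomes one between functions of [Psi], into which module actions enter as
    matrix products. *)
Lemma det_mul_relation (F : fieldType) (m n N : nat) (D : 'M[F]_(m, n))
    (r : 'I_N -> F) (C : 'I_N -> 'M[F]_(m, n)) :
    (forall f : incr m n, \det (\matrix_(a, b) D a (val f b)) =
       \sum_p r p * \det (\matrix_(a, b) C p a (val f b))) ->
  forall Psi : 'M[F]_(n, m),
    \det (D *m Psi) = \sum_p r p * \det (C p *m Psi).
Proof.
move=> rel Psi; rewrite det_mulmx_expand.
under [RHS]eq_bigr do rewrite det_mulmx_expand mulr_sumr.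
rewrite exchange_big /=; apply: eq_bigr => h _.
under [RHS]eq_bigr do rewrite mulrCA.
rewrite -mulr_sumr; congr (_ * _).
have [h0|[f [c hf]]] := minor_sort F h.
  by rewrite h0 big1 // => p _; rewrite h0 mulr0.
rewrite hf rel mulr_sumr; apply: eq_bigr => p _.
by rewrite hf mulrCA.
Qed.

(* If D z = 0 and w = D' z, then det (D' Psi) does not change when z u is added
   to Psi; a rank one perturbation w u of 1 by w <> 0 can be made singular. *)
Lemma det_proportional_sub (F : fieldType) (m n : nat) (D D' : 'M[F]_(m, n))
    (d : F) :
    row_free D -> d != 0 ->
    (forall Psi, \det (D' *m Psi) = d * \det (D *m Psi)) -> (D' <= D)%MS.
Proof.
move=> /row_freeP[Y DY] d0 rel.
rewrite submxE; apply/eqP/matrixP => a b; rewrite mxE.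
pose z := col b (cokermx D).
have Dz : D *m z = 0 by rewrite /z colE mulmxA mulmx_coker mul0mx.
suff /colP/(_ a) : D' *m z = 0 by rewrite /z colE mulmxA -colE !mxE.
set w := D' *m z; apply/eqP; apply: contraT => w0.
have [c wc] : exists c, w c 0 != 0.
  apply/existsP; apply: contraR w0 => /existsPn w0; apply/eqP/colP => c.
  by rewrite [RHS]mxE; have := w0 c; rewrite negbK => /eqP.
pose u : 'rV[F]_m := (w c 0)^-1 *: delta_mx 0 c.
have uw : u *m w = 1%:M.
  apply/matrixP => x y; rewrite -scalemxAl -rowE !ord1 mxE [row _ _ _ _]mxE.
  by rewrite mulVf // mxE.
pose G := D' *m Y.
have detG : \det G = d by rewrite rel DY det1 mulr1.
have Gu : G \in unitmx by rewrite unitmxE detG unitfE.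
have [H HE] : exists H, H + w *m u = 1%:M.
  by exists (1%:M - w *m u); rewrite subrK.
(* This [Psi] makes D' Psi = H + w u = 1, whereas D Psi = G^-1 H is singular because u H = 0. *)
have := rel (Y *m (invmx G *m H) + z *m u).
rewrite !mulmxDr !(mulmxA _ Y) !(mulmxA _ z) -/w -/G DY Dz mul0mx addr0.
rewrite mul1mx mulKVmx // HE det1 det_mulmx.
have -> : \det H = 0.
  apply/eqP/det0P; exists u; last first.
    by rewrite (canRL (addrK _) HE) mulmxBr mulmx1 mulmxA uw mul1mx subrr.
  apply/eqP => u0; have := uw; rewrite u0 mul0mx => /matrixP/(_ 0 0).
  by rewrite !mxE eqxx => /eqP; rewrite eq_sym oner_eq0.
by rewrite !mulr0 => /eqP; rewrite oner_eq0.
Qed.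

(** * Composition series *)

Section QuotientBimodule.
Variables (k F K : fieldType) (iF : {rmorphism k -> F}).
Variable (iK : {rmorphism k -> K}).
Variables (V : bimod iF iK) (W U : {vspace V}).
Hypotheses (sW : stable V W) (sU : stable V U) (WU : (W <= U)%VS).

(** The quotient U / W is modelled on the complement [X] of W in U; the projection [pi] along W
    plays the role of reduction modulo W. *)
Let pi : 'End(V) := daddv_pi W^C W.
Let X := (U :&: W^C)%VS.

Let WC0 : (W^C :&: W = 0)%VS. Proof. by rewrite capvC capv_compl. Qed.

Let pi_sub v : v - pi v \in W.
Proof.
rewrite -{1}(@daddv_pi_add _ _ W^C W v WC0); last first.
  by rewrite addvC addv_complf memvf.
by rewrite addrC addKr memv_pi.
Qed.

Let pi_W w : w \in W -> pi w = 0.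
Proof.
move=> wW; apply/eqP; rewrite -memv0 -WC0 memv_cap memv_pi /=.
by rewrite -[pi w](subKr w) memvB.
Qed.

Let pi_id v : v \in X -> pi v = v.
Proof. by rewrite memv_cap => /andP[_]; apply: daddv_pi_id. Qed.

Let pi_X u : u \in U -> pi u \in X.
Proof.
move=> uU; rewrite memv_cap memv_pi andbT -[pi u](subKr u).
by rewrite memvB // (subvP WU).
Qed.

Let pi_ract v x : pi (ract V (pi v) x) = pi (ract V v x).
Proof.
apply/esym/eqP; rewrite -subr_eq0 -linearB; apply/eqP/pi_W.
have := linearB (ractr V x) v (pi v); rewrite /ractr => <-.
exact: sW.
Qed.

Definition quo_ract (v : subvs_of X) (x : K) : subvs_of X :=
  vsproj X (pi (ract V (vsval v) x)).

Let vsval_quo v x : vsval (quo_ract v x) = pi (ract V (vsval v) x).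
Proof.
rewrite vsprojK // pi_X // sU //.
by have := subvsP v; rewrite memv_cap => /andP[].
Qed.

Fact quo_ract_linear x : linear (quo_ract^~ x).
Proof.
by move=> a u v; rewrite /quo_ract [vsval _]linearP ract_linear !linearP.
Qed.

Fact quo_ractD v x y : quo_ract v (x + y) = quo_ract v x + quo_ract v y.
Proof. by apply: subvs_inj; rewrite linearD /= !vsval_quo ractD linearD. Qed.

Fact quo_ract1 v : quo_ract v 1 = v.
Proof. by apply: subvs_inj; rewrite vsval_quo ract1 pi_id // subvsP. Qed.

Fact quo_ractM v x y : quo_ract v (x * y) = quo_ract (quo_ract v x) y.
Proof. by apply: subvs_inj; rewrite !vsval_quo ractM pi_ract. Qed.

Fact quo_ract_central v a : quo_ract v (iK a) = iF a *: v.
Proof.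
apply: subvs_inj; rewrite linearZ /= vsval_quo ract_central linearZ /=.
by rewrite pi_id // subvsP.
Qed.

Definition quo_bimod : bimod iF iK :=
  Bimod quo_ract_linear quo_ractD quo_ract1 quo_ractM quo_ract_central.

Lemma quo_bimodP : is_quotient W U quo_bimod.
Proof.
split=> //; split=> //; exists sU.
pose g := linfun (vsproj X \o pi \o vsval : sub_bimod sU -> quo_bimod).
have gE u : vsval (g u) = pi (vsval u).
  by rewrite lfunE /= vsprojK // pi_X // subvsP.
exists g; split.
- move=> v x; apply: subvs_inj.
  by rewrite gE [RHS]vsval_quo gE pi_ract vsval_sub_ract.
- apply/eqP; rewrite eqEsubv subvf /=; apply/subvP => t _.
  apply/memv_imgP; have tX := subvsP t.
  have tU : vsval t \in U by move: tX; rewrite memv_cap => /andP[].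
  exists (vsproj U (vsval t)); rewrite ?memvf //.
  by apply: subvs_inj; rewrite gE vsprojK // pi_id.
- move=> u; apply/eqP/idP => [gu|uW].
    by have := pi_sub (vsval u); rewrite -gE gu subr0.
  by apply: subvs_inj; rewrite gE pi_W.
Qed.

End QuotientBimodule.

Section CompositionSeries.
Variables (k F K : fieldType) (iF : {rmorphism k -> F}).
Variable (iK : {rmorphism k -> K}).
Implicit Types V T : bimod iF iK.

Definition covers V (W U : {vspace V}) : Prop :=
  [/\ (W <= U)%VS, W <> U &
    forall Y, stable V Y -> (W <= Y <= U)%VS -> Y = W \/ Y = U].

(** The preimage in V of a subbimodule of T is stable and lies between W and U, so it is one of the
    two. *)
Lemma covers_simple V (W U : {vspace V}) T :
  covers W U -> is_quotient W U T -> simple_bimod T.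
Proof.
move=> [WU neWU cov] [sW [_ [sU [f [fhom fsurj fker]]]]]; split.
  move=> T0; apply: neWU; apply/eqP; rewrite eqEsubv WU; apply/subvP => u uU.
  have := fker (vsproj U u); rewrite vsprojK // => <-.
  by rewrite -memv0 -T0 memvf.
move=> X sX; pose incl := linfun (vsval : sub_bimod sU -> V).
pose Y := (incl @: (f @^-1: X))%VS.
have YP v :
    reflect (exists2 u : sub_bimod sU, f u \in X & v = vsval u) (v \in Y).
  apply: (iffP memv_imgP) => -[u]; rewrite ?memv_preim => uX ->.
    by exists u => //; rewrite ?memv_preim // lfunE.
  by exists u; rewrite ?memv_preim // lfunE.
have sY : stable V Y.
  move=> _ x /YP[u uX ->]; apply/YP; exists (ract (sub_bimod sU) u x).
    by rewrite fhom sX.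
  by rewrite vsval_sub_ract.
have WYU : (W <= Y <= U)%VS.
  apply/andP; split; apply/subvP => v; last first.
    by move=> /YP[u _ ->]; apply: subvsP.
  move=> vW; apply/YP; exists (vsproj U v); last first.
    by rewrite vsprojK // (subvP WU).
  have /eqP -> : f (vsproj U v) == 0 by rewrite fker vsprojK // (subvP WU).
  exact: mem0v.
have fX t : t \in X -> exists2 u, vsval u \in Y & t = f u.
  move=> tX; have : t \in limg f by rewrite fsurj memvf.
  by case/memv_imgP=> u _ tE; exists u => //; apply/YP; exists u; rewrite -?tE.
case: (cov Y sY WYU) => YE; [left|right]; apply/eqP.
  rewrite -subv0; apply/subvP => t /fX[u]; rewrite YE -fker => /eqP -> ->.
  exact: mem0v.
rewrite eqEsubv subvf; apply/subvP => t _.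
have : t \in limg f by rewrite fsurj memvf.
case/memv_imgP=> u _ ->; have : vsval u \in Y by rewrite YE subvsP.
by case/YP=> u' u'X /subvs_inj ->.
Qed.

Lemma exists_cover V (W U : {vspace V}) :
    stable V U -> (W <= U)%VS -> W <> U ->
  exists2 U', stable V U' & covers W U' /\ (U' <= U)%VS.
Proof.
elim/ltn_ind: {U}(\dim U) {-2}U (erefl (\dim U)) => d IHd U dU sU WU neWU.
have [cov|ncov] := classic (covers W U); first by exists U.
have [Y [sY WY YU neYW neYU]] : exists Y,
    [/\ stable V Y, (W <= Y)%VS, (Y <= U)%VS, Y <> W & Y <> U].
  apply: NNPP => none; apply: ncov; split=> // Y sY /andP[WY YU].
  by apply: NNPP => /not_or_and[neW neU]; apply: none; exists Y.
have dY : (\dim Y < d)%N.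
  rewrite -dU ltn_neqAle dimvS // andbT; apply/eqP => dYU.
  by apply: neYU; apply/eqP; rewrite eqEdim YU dYU leqnn.
have [|U' sU' [cU' U'Y]] := IHd _ dY Y erefl sY WY.
  by move=> WYE; apply: neYW.
by exists U' => //; split=> //; apply: subv_trans YU.
Qed.

(** Climb by covers until V is reached. Starting at any stable W allows a prescribed bottom step in
    a composition series. *)
Lemma exists_series_from V (W : {vspace V}) : stable V W ->
  exists (l : nat) (c : nat -> {vspace V}),
    [/\ c 0%N = W, c l = fullv & forall p, (p < l)%N ->
      exists T, is_quotient (c p) (c p.+1) T /\ simple_bimod T].
Proof.
elim/ltn_ind: {W}(\dim {:V} - \dim W)%N {-2}W (erefl (\dim {:V} - \dim W)%N).
move=> d IHd W dW sW; have [->|/eqP neW] := eqVneq W fullv.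
  by exists 0%N, (fun=> fullv).
have sV : stable V fullv by move=> v x _; apply: memvf.
have [U sU [cov _]] := exists_cover sV (subvf W) neW.
have [WU neWU _] := cov.
have dimWU : (\dim W < \dim U)%N.
  rewrite ltn_neqAle dimvS // andbT; apply/eqP => dWU.
  by apply: neWU; apply/eqP; rewrite eqEdim WU dWU leqnn.
have dU : (\dim {:V} - \dim U < d)%N.
  by rewrite -dW ltn_sub2l // (leq_trans dimWU) // dimvS // subvf.
have [l [c [c0 cl cP]]] := IHd _ dU U erefl sU.
exists l.+1, (fun p => if p is q.+1 then c q else W); split=> // -[_|p /cP //].
rewrite c0; exists (quo_bimod sW sU WU).
have quo := quo_bimodP sW sU WU; split=> //; exact: covers_simple quo.
Qed.

Lemma sub_bimod_quotient V (U : {vspace V}) (sU : stable V U) :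
  is_quotient 0%VS U (sub_bimod sU).
Proof.
split.
  move=> v x; rewrite !memv0 => /eqP ->.
  by rewrite -[ract V 0 x]/(ractr V x 0) linear0.
split; first exact: sub0v.
exists sU, \1%VF; split=> [v x||u]; first by rewrite !lfunE.
  by rewrite lim1g.
by rewrite lfunE /= memv0 -(inj_eq (@subvs_inj _ _ U)) linear0.
Qed.

Lemma simple_dim_gt0 V : simple_bimod V -> (0 < \dim {:V})%N.
Proof. by case=> V0 _; rewrite lt0n dimv_eq0; apply/eqP. Qed.

(** A minimal nonzero stable U' inside U begins a composition series of V, hence is isomorphic to S
    by homogeneity; equality of dimensions then gives U' = U. *)
Lemma homogeneous_sub_iso V (S : bimod iF iK) (U : {vspace V})
    (sU : stable V U) :
  homogeneous V S -> simple_bimod S -> \dim U = \dim {:S} ->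
  bimod_iso (sub_bimod sU) S.
Proof.
move=> homV simS dimU.
have U0 : 0%VS <> U.
  by move=> U0; have := simple_dim_gt0 simS; rewrite -dimU -U0 dimv0.
have [U' sU' [cov U'U]] := exists_cover sU (sub0v U) U0.
have [l [c [c0 cl cP]]] := exists_series_from sU'.
pose c' p := if p is q.+1 then c q else 0%VS.
have quo := sub_bimod_quotient sU'.
have iso : bimod_iso (sub_bimod sU') S.
  apply: homV; exists l.+1, c', 0%N; split=> //; last by rewrite /c' c0.
  split=> // -[_|p /cP //]; exists (sub_bimod sU').
  by rewrite /c' c0; split=> //; apply: covers_simple quo.
have [f [fhom fbij]] := iso.
have dimU' : \dim U' = \dim {:S}.
  have f_inj : lker f == 0%VS by apply/lker0P/bij_inj.
  have f_surj : limg f = fullv.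
    apply/eqP; rewrite eqEsubv subvf; apply/subvP => t _.
    by have [g _ gK] := fbij; rewrite -[t]gK memv_img ?memvf.
  rewrite -f_surj limg_dim_eq ?(eqP f_inj) ?capv0 //.
  by rewrite dimvf.
have UE : U' = U by apply/eqP; rewrite eqEdim U'U dimU' dimU leqnn.
(* The stability proofs of U' and U differ, but [bimod_iso] only sees carrier and action, which do
   not depend on them. *)
by clear -iso UE; subst U'; exact: iso.
Qed.

End CompositionSeries.

(** Allows any positive size, so that the result applies at size [\dim {:S}]. *)
Lemma simple_intertwiner (K F : fieldType) (j : {rmorphism K -> F}) (m : nat)
    (T : K -> 'M[K]_m) (A : K -> 'M[F]_m) :
    perfect_field K -> (0 < m)%N ->
    T 1 = 1%:M -> (forall x y, T (x * y) = T x *m T y) ->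
    A 1 = 1%:M -> (forall x y, A (x * y) = A x *m A y) ->
    (forall U : 'M[K]_m,
       (forall x, (U *m T x <= U)%MS) -> U = 0 \/ row_full U) ->
    (forall N (c : 'I_N -> F) (x : 'I_N -> K),
       \det (\sum_p c p *: map_mx j (T (x p))) =
       \det (\sum_p c p *: A (x p))) ->
  exists2 Y : 'M[F]_m, Y \in unitmx &
    forall x, Y *m A x = map_mx j (T x) *m Y.
Proof. by case: m T A => // m T A perf _; apply: simple_intertwiner_succ. Qed.

(** * Bimodules in coordinates *)

Section MatrixOfBimodule.
Variables (k K : fieldType) (i : {rmorphism k -> K}).
Variable S : two_sided i.
Local Notation m := (\dim {:S}).
Let e := vbasis {:S}.
Let eB : basis_of {:S} e := vbasisP _.

Lemma rVof_ract s x : rVof e (ract S s x) = rVof e s *m bc_mx S x.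
Proof. by rewrite /bc_mx -rVof_app // lfunE. Qed.

Lemma bc_mx_irreducible : simple_bimod S ->
  forall U : 'M[K]_m, (forall x, (U *m bc_mx S x <= U)%MS) ->
  U = 0 \/ row_full U.
Proof.
move=> [_ simS] U sU.
have sUS : stable S (vsof e U).
  move=> v x; rewrite -!rVof_sub // rVof_ract => vU.
  by apply: submx_trans (sU x); apply: submxMr.
case: (simS _ sUS) => [/eqP|UE]; first by rewrite vsof_eq0 // => /eqP; left.
right; rewrite -sub1mx; apply/rV_subP => t _.
by rewrite -[t](vecofK eB) rVof_sub // UE memvf.
Qed.

(** The invariant subspace is a copy of S. [C] is the matrix of the resulting embedding of S into
    K^n, and [X] writes the given basis in terms of the rows of [C]. *)
Lemma invariant_basis_factor (n : nat) (phi : {rmorphism K -> 'M[K]_n})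
    (phi_central : forall a, phi (i a) = (i a)%:M)
    (v : m.-tuple 'rV[K]_n) :
    homogeneous (row_bimod phi_central) S -> simple_bimod S ->
    invariant_basis phi_central v ->
  exists (X : 'M[K]_m) (C : 'M[K]_(m, n)),
    (forall x, C *m phi x = bc_mx S x *m C) /\
    \matrix_a tnth v a = X *m C.
Proof.
move=> homV simS [U [dimU sU vB]].
have [g [ghom gbij]] := homogeneous_sub_iso sU homV simS dimU.
have [h0 _ h0K] := gbij; pose h := (g^-1)%VF.
have hK : cancel g h by apply: lker0_lfunK; apply/lker0P/bij_inj.
have gK : cancel h g by move=> t; rewrite -[t in RHS]h0K -[h0 t]hK h0K.
have hhom t x : h (ract S t x) = ract (sub_bimod sU) (h t) x.
  by apply: (can_inj hK); rewrite ghom !gK.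
pose C := \matrix_(a < m) (vsval (h e`_a) : 'rV[K]_n).
have uC u : u *m C = vsval (h (vecof e u)).
  rewrite /vecof !linear_sum mulmx_sum_row; apply: eq_bigr => a _.
  by rewrite !linearZ rowK.
exists (\matrix_a rVof e (g (vsproj U (tnth v a)))), C; split=> [x|].
  apply/row_matrixP => a; rewrite !row_mul rowK rowE -(rVofE eB) -rVof_ract.
  by rewrite uC rVofK // hhom vsval_sub_ract.
apply/row_matrixP => a; rewrite row_mul !rowK uC rVofK // hK vsprojK //.
by rewrite -(span_basis vB) memv_span ?mem_tnth.
Qed.

End MatrixOfBimodule.

(** * From the Pluecker vector of M to the isomorphism *)

Theorem theorem6p10 (k K F : fieldType)
    (i : {rmorphism k -> K}) (j : {rmorphism K -> F})
    (n m : nat) (phi : {rmorphism K -> 'M[K]_n})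
    (phi_central : forall a : k, phi (i a) = (i a)%:M)
    (S : two_sided i)
    (S_simple : simple_bimod S) (dimS : \dim {:S} = m)
    (V_homogeneous : homogeneous (row_bimod phi_central) S)
    (k_large : card_gt k m) (K_perfect : perfect_field K)
    (M : {vspace 'rV[F]_n})
    (M_family : free_rank_family j phi_central m M) :
  exists sM : stable (ext_row_bimod j phi_central) M,
    bimod_iso (sub_bimod sM) (base_change j S).
Proof.
subst m; set m := \dim {:S} in M_family.
have [dimM [N [r [v [v_inv [w_span _]]]]]] := M_family.
have [X X_P] := fin_all_exists
  (fun p => invariant_basis_factor V_homogeneous S_simple (v_inv p)).
have [C CP] := fin_all_exists X_P.
pose T x := map_mx j (bc_mx S x); pose Phi x := map_mx j (phi x).
have CPhi p x : map_mx j (C p) *m Phi x = T x *m map_mx j (C p).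
  by rewrite -!map_mxM (CP p).1.
(* The basis of M is retyped as an [m]-tuple, [dimM] being only a propositional equality. *)
pose e := [tuple (vbasis M)`_a | a < m].
have eB : basis_of M e.
  suff -> : e = vbasis M :> seq _ by apply: vbasisP.
  apply: (@eq_from_nth _ 0) => [|a];
    rewrite size_tuple ?size_tuple ?dimM // => am.
  by rewrite -[a]/(nat_of_ord (Ordinal am)) -tnth_nth tnth_mktuple.
have eM a : tnth e a \in M by rewrite (basis_mem eB) ?mem_tnth.
pose D := \matrix_(a < m) tnth e a.
have DM (u : 'rV[F]_m) : u *m D \in M.
  by rewrite mulmx_sum_row; apply: rpred_sum => a _; rewrite rowK memvZ.
have MD u : u \in M -> (u <= D)%MS.
  move/(coord_basis eB) ->; apply: summx_sub => a _; apply: scalemx_sub.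
  by rewrite -tnth_nth -(rowK (fun a => tnth e a)) row_sub.
have D_free : row_free D.
  rewrite -kermx_eq0; apply/rowV0P => u /sub_kermxP.
  rewrite mulmx_sum_row => uD; apply/rowP => a; rewrite mxE.
  have /freeP := basis_free eB; apply; rewrite -[RHS]uD.
  by apply: eq_bigr => b _; rewrite rowK -tnth_nth.
have [Y DY] := row_freeP D_free.
have [c eE] : exists c, wedge e =
    c *: \sum_p r p *: wedge (map_tuple (map_mx j) (v p)).
  by apply/vlineP/w_span; exists e; split=> // _ /tnthP[a ->].
(* The base changes [X p] contribute only scalars, leaving matrices [C p] that all intertwine with
   the same [T]. *)
have rel Psi : \det (D *m Psi) =
    \sum_p (c * r p * j (\det (X p))) * \det (map_mx j (C p) *m Psi).
  apply: det_mul_relation => f.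
  transitivity (wedge e f).
    by rewrite ffunE; congr (\det _); apply/matrixP => a b; rewrite !mxE.
  rewrite eE ffunE sum_ffunE scaler_sumr; apply: eq_bigr => p _.
  pose d := \det (\matrix_(a < m, b < m)
    tnth (map_tuple (map_mx j) (v p)) a 0 (val f b)).
  suff dE : d = j (\det (X p)) *
      \det (\matrix_(a, b) map_mx j (C p) a (val f b)).
    by rewrite !ffunE -[LHS]/(c * (r p * d)) dE !mulrA.
  rewrite -det_map_mx -det_mulmx; congr (\det _); apply/matrixP => a b.
  have := congr1 (fun A : 'M__ => j (A a (val f b))) (CP p).2.
  rewrite !mxE tnth_map mxE => ->; rewrite rmorph_sum; apply: eq_bigr => l _.
  by rewrite !mxE rmorphM.
(* Moving an element of F (x)_k K across any [C p] yields the same left factor, whose determinant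
   leaves the sum. *)
have relPhi N' (d : 'I_N' -> F) (x : 'I_N' -> K) Psi :
    \det (D *m (\sum_q d q *: Phi (x q)) *m Psi) =
    \det (\sum_q d q *: T (x q)) * \det (D *m Psi).
  rewrite -mulmxA !rel mulr_sumr; apply: eq_bigr => p _.
  rewrite mulrCA; congr (_ * _).
  rewrite -det_mulmx !mulmxA; congr (\det (_ *m _)).
  rewrite mulmx_sumr mulmx_suml; apply: eq_bigr => q _.
  by rewrite -scalemxAr CPhi scalemxAl.
have relPhi1 x Psi : \det (D *m Phi x *m Psi) = \det (T x) * \det (D *m Psi).
  by have := relPhi 1%N (fun=> 1) (fun=> x) Psi; rewrite !big_ord1 !scale1r.
have TM x y : bc_mx S (x * y) = bc_mx S x *m bc_mx S y by apply: bc_mxM.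
(* For nonzero [x] the scalar det (T x) is nonzero because [x] is invertible, so
   [det_proportional_sub] applies. *)
have DPhi_sub x : (D *m Phi x <= D)%MS.
  have [->|x0] := eqVneq x 0.
    by rewrite /Phi rmorph0 map_mx0 mulmx0 sub0mx.
  apply: (det_proportional_sub D_free _ (relPhi1 x)).
  rewrite -unitfE -unitmxE map_unitmx.
  have xV : bc_mx S x *m bc_mx S x^-1 = 1%:M by rewrite -TM mulfV // bc_mx1.
  by have [] := mulmx1_unit xV.
(* The action of [x] on M in the basis [e]: right multiplication by [Y] reads off coordinates. *)
pose A x := D *m Phi x *m Y.
have AD x : D *m Phi x = A x *m D.
  have /submxP[B DB] := DPhi_sub x.
  by rewrite /A DB -[B *m D *m Y]mulmxA DY mulmx1.
have sM : stable (ext_row_bimod j phi_central) M.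
  move=> u x /MD/submxP[t ->].
  by rewrite /= /row_ract -mulmxA AD mulmxA DM.
have [Z Zu ZP] : exists2 Z : 'M[F]_m, Z \in unitmx &
    forall x, Z *m A x = map_mx j (bc_mx S x) *m Z.
  apply: simple_intertwiner => //.
  - exact: simple_dim_gt0.
  - exact: bc_mx1.
  - by rewrite /A /Phi rmorph1 map_mx1 mulmx1.
  - move=> x y; rewrite {1}/A /Phi rmorphM map_mxM mulmxA -/(Phi x) -/(Phi y).
    by rewrite AD -[A y]/(D *m Phi y *m Y) !mulmxA.
  - exact: bc_mx_irreducible.
  (* Equality of determinants is [relPhi] at Psi = Y, where D Y = 1. *)
  - move=> N' d x; rewrite -[LHS]mulr1 -(det1 F m) -DY -relPhi.
    congr (\det _); rewrite mulmx_sumr mulmx_suml; apply: eq_bigr => q _.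
    by rewrite -scalemxAr -scalemxAl.
exists sM.
(* [Y] takes coordinates in the basis of M and the inverse of [Z] turns them into coordinates on F
   (x)_K S; the inverse map is right multiplication by Z D. *)
pose f := linfun
  (mulmxr (Y *m invmx Z) \o vsval : sub_bimod sM -> base_change j S).
have fE u : f u = vsval u *m (Y *m invmx Z) by rewrite lfunE.
have MYD u : u \in M -> u *m Y *m D = u.
  by move/MD/submxP=> [t ->]; rewrite -(mulmxA t) DY mulmx1.
exists f; split=> [u x|].
  rewrite !fE (vsval_sub_ract sM) /= /row_ract /bc_ract.
  have uM := subvsP u; move: (vsval u) uM => {u} u uM.
  rewrite -{1}(MYD u uM) -!mulmxA; congr (u *m (Y *m _)).
  rewrite !mulmxA -[_ *m Y]/(A x) -[LHS](mulKmx Zu) (mulmxA Z) ZP.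
  by rewrite mulmxK.
exists (fun t : base_change j S => vsproj M (t *m (Z *m D))) => [u|t].
  apply: subvs_inj; rewrite fE !mulmxA mulmxKV // MYD ?subvsP //.
  by rewrite vsprojK ?subvsP.
rewrite fE vsprojK; last by rewrite mulmxA DM.
by rewrite -!mulmxA (mulmxA D) DY mul1mx mulmxV // mulmx1.
Qed.
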